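(* Let $n \ge 2$ be an integer and let $j,k$ be integers with $1 \le j,k \le \lfloor \frac{n}{2} \rfloor$. Then there exist a normal operator $D \in \mathbb{M}_n(\mathbb{C})$ and an orthogonal projection $P \in \mathbb{M}_n(\mathbb{C})$ such that, writing \[ D=\begin{bmatrix} D_1 & D_2 \\ D_3 & D_4 \end{bmatrix} \] relative to the decomposition $\mathbb{C}^n = \mathrm{ran}\, P \oplus \mathrm{ran}\, (I-P)$, we have $\mathrm{rank}\, D_2 = k$ and $\mathrm{rank}\, D_3 = j$.
   Context: $\mathbb{M}_n(\mathbb{C})$ is the algebra of $n\times n$ complex matrices, identified with the operators on the Hilbert space $\mathbb{C}^n$. An orthogonal projection is $P$ with $P=P^2=P^*$. In the block decomposition relative to $\mathrm{ran}\,P\oplus\mathrm{ran}\,(I-P)$, $D_2:\mathrm{ran}\,(I-P)\to\mathrm{ran}\,P$ is the compression $PD(I-P)$ and $D_3:\mathrm{ran}\,P\to\mathrm{ran}\,(I-P)$ is $(I-P)DP$; so $\mathrm{rank}\,D_2=\mathrm{rank}\,PD(I-P)$ and $\mathrm{rank}\,D_3=\mathrm{rank}\,(I-P)DP$. *)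

(* Defs.v *)
From mathcomp Require Import all_boot all_order all_algebra.
From mathcomp Require Import sesquilinear spectral.
From mathcomp Require Import reals complex.

Set Implicit Arguments.
Unset Strict Implicit.
Unset Printing Implicit Defensive.

Import Order.TTheory GRing.Theory Num.Theory.

Local Open Scope ring_scope.
Local Open Scope sesquilinear_scope.

Definition orthogonal_projection (C : numClosedFieldType) (n : nat)
    (P : 'M[C]_n) : Prop :=
  P = P *m P /\ P = P ^t*.

(* Matrices act on column vectors.  The off-diagonal blocks of D relative to
   ran P (+) ran (I - P) are kept as n x n matrices, i.e. extended by zero on
   the complementary summand, which does not affect their rank. *)

(* D_2 : ran (I - P) -> ran P *)
Definition upper_block (C : numClosedFieldType) (n : nat)
    (P D : 'M[C]_n) : 'M[C]_n :=
  P *m D *m (1%:M - P).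

(* D_3 : ran P -> ran (I - P) *)
Definition lower_block (C : numClosedFieldType) (n : nat)
    (P D : 'M[C]_n) : 'M[C]_n :=
  (1%:M - P) *m D *m P.

(* Main.v *)
Require Import Defs.
From mathcomp Require Import all_boot all_order all_algebra.
From mathcomp Require Import sesquilinear spectral.
From mathcomp Require Import reals complex.
From mathcomp Require Import zify.

(** Pairs of ranks add up under orthogonal direct sums of pairs (D, P)
    ([offdiag_ranksD]), and passing from D to its adjoint swaps the two ranks
    ([offdiag_ranks_sym]).  So it suffices to realize the extreme pair (1, p)
    in dimension 2p ([offdiag_ranks_1_max]): for 1 <= j <= k and 2k <= n, take
    p = k - j + 1, add j - 1 copies of the pair (1, 1) in dimension 2, and fill
    up with zeros.

    For the extreme pair, let D = diag(a, b) with a and b two lists of p complex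
    numbers, and let P be the projection onto the graph of a p x p matrix M.
    The graph is invariant under D exactly when diag(a) M = M diag(b), and the
    displacement diag(a) M - M diag(b) turns out to have the rank of an
    off-diagonal corner of D ([offdiag_ranks_graph]).  The other corner is the
    same thing for the adjoint of D.  Entrywise the two displacements are
    (a_s - b_t) M_st and (a_s - b_t)^* M_st.  With M_st = 1 / (a_s - b_t) the
    former is the all-ones matrix, of rank 1.  Choosing a_s real and b_t purely
    imaginary makes the latter (a_s + b_t) / (a_s - b_t), a Cauchy-like matrix
    which is invertible, if also a_0 = 0, by counting the roots of a polynomial
    ([cauchy_type_row_free]). *)

Set Implicit Arguments.
Unset Strict Implicit.
Unset Printing Implicit Defensive.

Import Order.TTheory GRing.Theory Num.Theory.

Local Open Scope ring_scope.
Local Open Scope sesquilinear_scope.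

Definition offdiag_ranks (C : numClosedFieldType) (n j k : nat) : Prop :=
  exists D P : 'M[C]_n,
    [/\ D \is normalmx,
        orthogonal_projection P,
        \rank (upper_block P D) = k
      & \rank (lower_block P D) = j].

(** * Adjoints, swapping and direct sums *)

Section Corners.
Variable C : numClosedFieldType.

Lemma adjmxM m n p (A : 'M[C]_(m, n)) (B : 'M[C]_(n, p)) :
  (A *m B)^t* = B^t* *m A^t*.
Proof. by rewrite trmx_mul map_mxM. Qed.

Lemma adjmxK m n (A : 'M[C]_(m, n)) : (A^t*)^t* = A.
Proof. by apply/matrixP=> i j; rewrite !mxE conjCK. Qed.

Lemma adjmx_diag n (d : 'rV[C]_n) :
  (diag_mx d)^t* = diag_mx (map_mx Num.conj d).
Proof. by rewrite tr_diag_mx map_diag_mx. Qed.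

Lemma adjmx_block m n (A : 'M[C]_m) (B : 'M[C]_n) :
  (block_mx A 0 0 B)^t* = block_mx (A^t*) 0 0 (B^t*).
Proof. by rewrite tr_block_mx map_block_mx !trmx0 !map_mx0. Qed.

Lemma normalmx_adj n (D : 'M[C]_n) : D \is normalmx -> D^t* \is normalmx.
Proof. by move=> /normalmxP nD; apply/normalmxP; rewrite adjmxK. Qed.

Lemma normalmx_diag n (d : 'rV[C]_n) : diag_mx d \is normalmx.
Proof. by apply/normalmxP; rewrite adjmx_diag diag_mxC. Qed.

Lemma normalmx_block m n (A : 'M[C]_m) (B : 'M[C]_n) :
  A \is normalmx -> B \is normalmx -> block_mx A 0 0 B \is normalmx.
Proof.
move=> /normalmxP nA /normalmxP nB; apply/normalmxP.
by rewrite adjmx_block !mulmx_block !mulmx0 !mul0mx !addr0 !add0r nA nB.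
Qed.

Lemma upper_block_adj n (P D : 'M[C]_n) :
  orthogonal_projection P -> upper_block P (D^t*) = (lower_block P D)^t*.
Proof.
move=> [_ adjP]; rewrite /upper_block /lower_block !adjmxM -adjP mulmxA.
by rewrite [(1%:M - P)^T]linearB map_mxB /= trmx1 map_mx1 -adjP.
Qed.

Lemma rank_lower_block n (P D : 'M[C]_n) :
  orthogonal_projection P ->
  \rank (lower_block P D) = \rank (upper_block P (D^t*)).
Proof. by move=> oP; rewrite upper_block_adj // mxrank_map mxrank_tr. Qed.

(** The two corners of the adjoint of D are the adjoints of the corners of D,
    exchanged. *)
Lemma offdiag_ranks_sym n j k : offdiag_ranks C n j k -> offdiag_ranks C n k j.
Proof.
move=> [D [P [nD oP rD2 rD3]]]; exists (D^t*), P; split=> //.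
- exact: normalmx_adj.
- by rewrite -rank_lower_block.
- by rewrite rank_lower_block // adjmxK.
Qed.

(** Serves to pad a construction up to dimension n. *)
Lemma offdiag_ranks0 n : offdiag_ranks C n 0 0.
Proof.
exists 0, 0; split.
- by apply/normalmxP; rewrite mul0mx trmx0 map_mx0 mulmx0.
- by split; rewrite ?mulmx0 // trmx0 map_mx0.
- by rewrite /upper_block !mul0mx mxrank0.
- by rewrite /lower_block !mulmx0 mxrank0.
Qed.

Lemma offdiag_ranksD n1 n2 j1 j2 k1 k2 :
  offdiag_ranks C n1 j1 k1 -> offdiag_ranks C n2 j2 k2 ->
  offdiag_ranks C (n1 + n2) (j1 + j2) (k1 + k2).
Proof.
move=> [D1 [P1 [nD1 [idP1 adjP1] <- <-]]] [D2 [P2 [nD2 [idP2 adjP2] <- <-]]].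
have oneB : 1%:M - block_mx P1 0 0 P2 = block_mx (1%:M - P1) 0 0 (1%:M - P2).
  by rewrite scalar_mx_block opp_block_mx add_block_mx !oppr0 !addr0.
exists (block_mx D1 0 0 D2), (block_mx P1 0 0 P2); split.
- exact: normalmx_block.
- split; last by rewrite adjmx_block -adjP1 -adjP2.
  by rewrite mulmx_block !mulmx0 !mul0mx !addr0 !add0r -idP1 -idP2.
- rewrite /upper_block oneB !mulmx_block !mulmx0 !mul0mx !addr0 !add0r.
  by rewrite !mul0mx rank_diag_block_mx.
- rewrite /lower_block oneB !mulmx_block !mulmx0 !mul0mx !addr0 !add0r.
  by rewrite !mul0mx rank_diag_block_mx.
Qed.

(** * Projections onto graphs *)

(** If S is an orthonormal basis of the row space of U, written as rows, then
    S^* S is the projection. *)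
Lemma orthogonal_projection_onto m n (U : 'M[C]_(m, n)) :
  row_free U -> exists2 P : 'M[C]_n, orthogonal_projection P & (P :=: U)%MS.
Proof.
move=> freeU; have le_mn : (m <= n)%N by rewrite -(eqP freeU) rank_leq_col.
have /unitarymxP SS1 := schmidt_unitarymx U le_mn.
have eqSU := eqmx_schmidt_free freeU; set S := schmidt U in SS1 eqSU.
exists (S^t* *m S).
  by split; rewrite ?adjmxM ?adjmxK // mulmxA -(mulmxA _ S) SS1 mulmx1.
apply: eqmx_trans eqSU; apply/eqmxP; rewrite submxMl /=.
by rewrite -{1}[S]mul1mx -SS1 -mulmxA submxMl.
Qed.

(** The rows of U = (1, M) span the graph of M, and the columns of N, the block M
    above the block -1, span the right kernel of U.  Hence P has the row space of U,
    while 1 - P has the column space of N; multiplying D by P on the left and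
    by 1 - P on the right therefore gives the same rank as U D N, although U
    and N are not orthonormal. *)
Lemma graph_projection p q (M : 'M[C]_(p, q)) :
  exists2 P : 'M[C]_(p + q), orthogonal_projection P &
    forall D, \rank (upper_block P D)
            = \rank (row_mx 1%:M M *m D *m col_mx M (- 1%:M)).
Proof.
set U := row_mx _ _; set N := col_mx _ _.
have UN0 : U *m N = 0 by rewrite mul_row_col mul1mx mulmxN mulmx1 subrr.
have freeU : row_free U.
  apply/row_freeP; exists (col_mx 1%:M 0).
  by rewrite mul_row_col mulmx1 mulmx0 addr0.
have [P oP eqPU] := orthogonal_projection_onto freeU; exists P => // D.
have [idP _] := oP.
have /submxP[X defP] : (P <= U)%MS by rewrite eqPU.
have /submxP[Y defU] : (U <= P)%MS by rewrite eqPU.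
have UQ0 : U *m (1%:M - P) = 0.
  by rewrite mulmxBr mulmx1 {2}defU -mulmxA -idP -defU subrr.
have QN : (1%:M - P) *m N = N.
  by rewrite mulmxBl mul1mx defP -mulmxA UN0 mulmx0 subr0.
have [Z defQ] : exists Z, 1%:M - P = N *m Z.
  exists (row_mx 0 (- 1%:M) *m (1%:M - P)).
  (* 1 - P kills U, so only the N-part of this decomposition of 1 survives. *)
  have split1 : col_mx 1%:M 0 *m U + N *m row_mx 0 (- 1%:M) = 1%:M.
    rewrite !mul_col_row add_block_mx scalar_mx_block !mul1mx !mul0mx !mulmx0.
    by rewrite mulmxN mulmx1 mulNmx mul1mx opprK subrr addr0 !add0r.
  rewrite mulmxA -[LHS]mul1mx -{1}split1 mulmxDl -(mulmxA _ U) UQ0.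
  by rewrite mulmx0 add0r.
apply/eqP; rewrite eqn_leq /upper_block; apply/andP; split.
  rewrite defQ {1}defP -!mulmxA (leq_trans (mxrankM_maxr _ _)) // !mulmxA.
  exact: mxrankM_maxl.
rewrite {1}defU -{1}QN -!mulmxA (leq_trans (mxrankM_maxr _ _)) // !mulmxA.
exact: mxrankM_maxl.
Qed.

(** For D = diag(a, b) the product U D N of [graph_projection] is the
    displacement diag(a) M - M diag(b), with entries (a_s - b_t) M_st. *)
Lemma offdiag_ranks_graph p q (a : 'rV[C]_p) (b : 'rV[C]_q) (M : 'M[C]_(p, q)) :
  offdiag_ranks C (p + q)
    (\rank (\matrix_(s, t) ((a 0 s - b 0 t)^* * M s t)))
    (\rank (\matrix_(s, t) ((a 0 s - b 0 t) * M s t))).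
Proof.
have [P oP rankP] := graph_projection M.
have rank_diag (c : 'rV[C]_p) (d : 'rV[C]_q) :
    \rank (upper_block P (block_mx (diag_mx c) 0 0 (diag_mx d)))
  = \rank (\matrix_(s, t) ((c 0 s - d 0 t) * M s t)).
  rewrite rankP mul_row_block mul_row_col !mulmx0 addr0 add0r mul1mx.
  congr (\rank _); apply/matrixP=> s t.
  by rewrite mulmxN mulmx1 mul_diag_mx mul_mx_diag !mxE mulrBl [M s t * _]mulrC.
exists (block_mx (diag_mx a) 0 0 (diag_mx b)), P; split=> //.
- by rewrite normalmx_block ?normalmx_diag.
- rewrite rank_lower_block // adjmx_block !adjmx_diag rank_diag.
  by congr (\rank _); apply/matrixP=> s t; rewrite !mxE rmorphB.
Qed.

End Corners.

(** * The extreme pair *)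

Section Cauchy.
Variable F : fieldType.

(** A vector x in the left kernel gives the rational function
    sum_s x_s (a_s + y) / (a_s - y), which vanishes at every b_t.  Clearing
    denominators gives a polynomial of degree at most q + 1 that vanishes at the
    q + 1 points b_t, one short of what forces it to be zero.  The condition
    a_0 = 0 supplies the missing root, at y = 0: the term s = 0 vanishes there
    through its factor a_0 + y, the others through the factor a_0 - y of their
    cleared denominators.  So the polynomial is zero.  Its value at a_s gives
    x_s = 0 when s != 0, and then any column of the matrix gives x_0 = 0. *)
Lemma cauchy_type_row_free q (a b : 'I_q.+1 -> F) :
  injective a -> injective b -> a ord0 = 0 ->
  (forall s, s != ord0 -> a s + a s != 0) ->
  (forall s t, a s != b t) ->
  row_free (\matrix_(s, t) ((a s + b t) / (a s - b t))).
Proof.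
move=> inj_a inj_b a0 a2_neq0 neq_ab; apply: inj_row_free => x xK.
have eval t : \sum_s x 0 s * ((a s + b t) / (a s - b t)) = 0.
  have /matrixP/(_ 0 t) := xK; rewrite !mxE => {2}<-.
  by apply: eq_bigr => s _; rewrite mxE.
have b_neq0 t : b t != 0 by rewrite eq_sym -a0 neq_ab.
pose L s : {poly F} := \prod_(r | r != s) ((a r)%:P - 'X).
pose f : {poly F} := \sum_s x 0 s *: (((a s)%:P + 'X) * L s).
have size_L s : (size (L s) <= q.+1)%N.
  rewrite (leq_trans (size_poly_prod_leq _ _)) //.
  have sz r : (size ((a r)%:P - 'X : {poly F})%R <= 2)%N.
    by rewrite -opprB size_polyN size_XsubC.
  have card_neq : #|[pred r : 'I_q.+1 | r != s]| = q by rewrite cardC1 card_ord.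
  rewrite card_neq leq_subLR (@leq_trans (q * 2).+1) //; last by lia.
  by rewrite ltnS -[X in (X * 2)%N]card_neq -sum_nat_const leq_sum.
have f0 : f = 0.
  apply: (@roots_geq_poly_eq0 _ f (0 :: codom b)).
  - rewrite /= {1}/root /f horner_sum big1 ?eqxx /=; last first.
      move=> s _; rewrite hornerZ hornerM hornerD hornerC hornerX addr0.
      have [->|s_neq0] := eqVneq s ord0; first by rewrite a0 mul0r mulr0.
      rewrite horner_prod (bigD1 ord0) 1?eq_sym //= !hornerE a0.
      by rewrite subr0 /= mulr0 mul0r.
    apply/allP=> _ /codomP[t ->]; rewrite /root /f horner_sum.
    rewrite (eq_bigr (fun s => (x 0 s * ((a s + b t) / (a s - b t)))
                             * \prod_r (a r - b t))).
      by rewrite -mulr_suml eval mul0r.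
    move=> s _; rewrite [in RHS](bigD1 s) //= !hornerE horner_prod /= -!mulrA.
    rewrite mulKf ?subr_eq0 ?neq_ab //; congr (_ * (_ * _)).
    by apply: eq_bigr => r _; rewrite !hornerE.
  - rewrite /= map_inj_uniq // enum_uniq andbT.
    by apply/codomP=> -[t /esym/eqP]; rewrite (negPf (b_neq0 t)).
  - rewrite /= size_codom card_ord (leq_trans (size_sum _ _ _)) //.
    apply/bigmax_leqP=> s _; rewrite (leq_trans (size_scale_leq _ _)) //.
    rewrite (leq_trans (size_polyMleq _ _)) //.
    have := size_L s; rewrite addrC size_XaddC; lia.
have x0 s : s != ord0 -> x 0 s = 0.
  move=> s_neq0; have := congr1 (horner^~ (a s)) f0.
  rewrite horner0 /f horner_sum (bigD1 s) //= big1 ?addr0; last first.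
    move=> r r_neqs; rewrite !hornerE horner_prod (bigD1 s) 1?eq_sym //=.
    by rewrite !hornerE subrr /= mulr0 mul0r.
  rewrite !hornerE horner_prod => /eqP.
  rewrite !mulf_eq0 (negPf (a2_neq0 _ s_neq0)) orbF.
  case/orP=> [/eqP //|/prodf_eq0[r r_neqs]]; rewrite !hornerE subr_eq0.
  by move=> /eqP/inj_a/eqP; rewrite (negPf r_neqs).
apply/rowP=> s; rewrite mxE; have [->|/x0 //] := eqVneq s ord0.
have := eval ord0; rewrite (bigD1 ord0) //= big1 ?addr0; last first.
  by move=> r /x0 ->; rewrite mul0r.
rewrite a0 add0r sub0r => /eqP; rewrite !mulf_eq0 invr_eq0 oppr_eq0.
by rewrite (negPf (b_neq0 _)) !orbF => /eqP.
Qed.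

End Cauchy.

Section Extremal.
Variable C : numClosedFieldType.

(** The choice a_s = s, b_t = i (t + 1) makes all differences nonzero,
    conjugation acts on them by (a_s - b_t)^* = a_s + b_t, and a_0 = 0 as
    [cauchy_type_row_free] requires. *)
Lemma offdiag_ranks_1_max q : offdiag_ranks C (q.+1 + q.+1) 1 q.+1.
Proof.
apply: offdiag_ranks_sym.
pose a (s : 'I_q.+1) : C := s%:R; pose b (t : 'I_q.+1) : C := 'i * t.+1%:R.
have inj_a : injective a.
  by move=> s t /eqP; rewrite eqr_nat => /eqP/val_inj.
have inj_b : injective b.
  by move=> s t /(mulfI (neq0Ci C))/eqP; rewrite eqr_nat eqSS => /eqP/val_inj.
have neq_ab s t : a s != b t.
  apply/eqP=> /(congr1 (fun z => z ^+ 2))/eqP.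
  (* The squares s^2 and - (t + 1)^2 differ, as their difference is a positive
     integer. *)
  rewrite exprMn sqrCi mulN1r -addr_eq0 -!natrX -natrD pnatr_eq0.
  by rewrite addn_eq0 !expn_eq0 andbF.
have := offdiag_ranks_graph (\row_s a s) (\row_t b t)
          (\matrix_(s, t) (a s - b t)^-1).
set X := \matrix_(s, t) _; set Y := \matrix_(s, t) _.
have -> : \rank X = q.+1.
  apply/eqP; rewrite [_ == _]/(row_free X).
  have -> : X = \matrix_(s, t) ((a s + b t) / (a s - b t)).
    apply/matrixP=> s t; rewrite !mxE rmorphB /= conjC_nat.
    by rewrite rmorphM /= conjCi conjC_nat mulNr opprK.
  apply: cauchy_type_row_free => // s s_neq0.
  by rewrite -natrD pnatr_eq0 addn_eq0 andbb.
have -> : Y = const_mx 1.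
  by apply/matrixP=> s t; rewrite !mxE divff // subr_eq0.
suff -> : \rank (const_mx 1 : 'M[C]_q.+1) = 1%N by [].
apply/eqP; rewrite eqn_leq lt0n mxrank_eq0; apply/andP; split.
  have -> : const_mx 1
          = (const_mx 1 : 'cV[C]_q.+1) *m (const_mx 1 : 'rV[C]_q.+1).
    by apply/matrixP=> s t; rewrite !mxE big_ord1 !mxE mulr1.
  exact: leq_trans (mxrankM_maxl _ _) (rank_leq_col _).
by apply/eqP=> /matrixP/(_ ord0 ord0)/eqP; rewrite !mxE oner_eq0.
Qed.

(** * Arbitrary pairs *)

Lemma offdiag_ranks_diag m : offdiag_ranks C (m + m) m m.
Proof.
elim: m => [|m IHm]; first exact: offdiag_ranks0.
have := offdiag_ranksD (offdiag_ranks_1_max 0) IHm.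
by have -> : (1 + 1 + (m + m) = m.+1 + m.+1)%N by lia.
Qed.

Lemma offdiag_ranks_le n j k :
  (0 < j <= k)%N -> (k + k <= n)%N -> offdiag_ranks C n j k.
Proof.
move=> jk kn.
have := offdiag_ranksD (offdiag_ranksD (offdiag_ranks_1_max (k - j))
  (offdiag_ranks_diag j.-1)) (offdiag_ranks0 C (n - (k + k))).
have -> : ((k - j).+1 + (k - j).+1 + (j.-1 + j.-1) + (n - (k + k)) = n)%N.
  by lia.
have -> : (1 + j.-1 + 0 = j)%N by lia.
by have -> : ((k - j).+1 + j.-1 + 0 = k)%N by lia.
Qed.

End Extremal.

Unset Implicit Arguments.

Theorem theorem2p5 (R : realType) (n : nat) (hn : (2 <= n)%N) (j k : nat)
    (hj : (1 <= j <= n %/ 2)%N) (hk : (1 <= k <= n %/ 2)%N) :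
  exists D P : 'M[R[i]]_n,
    [/\ D \is normalmx,
        orthogonal_projection P,
        \rank (upper_block P D) = k
      & \rank (lower_block P D) = j].
Proof.
have [le_jk|/ltnW le_kj] := leqP j k.
  by apply: offdiag_ranks_le; lia.
by apply: offdiag_ranks_sym; apply: offdiag_ranks_le; lia.
Qed.
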